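(* Let $c\ge 1$ and consider an SDM on $n$ nodes with step limit $\tau$ that satisfies, for every set $T\subset V$, the variance bound $$\operatorname{Var}[R^\tau(T)]\le c\,I^\tau(T)\max\Big\{I^\tau(T),\max_{v\in V}I^\tau(\{v\})\Big\}.$$ Then for any $\epsilon\in(0,1)$, $\delta\in(0,1)$ and $1\le s\le n$, using $112\,\epsilon^{-2}\,c\,s\,\ln\frac{n}{\delta}$ i.i.d. simulations of the model one can return a set $T\subset V$ with $|T|\le s$ such that $$\Pr\big[I^\tau(T)\ge(1-2\epsilon)\,\mathrm{OPT}^\tau_s\big]\ge 1-\delta .$$ Here ''one can return'' means: there is a (computationally unrestricted) procedure whose only access to the model's distribution is through the given i.i.d. simulations.
   Context: $V$ is a finite set, $|V|=n$. A stochastic diffusion model (SDM) $\mathcal{G}(V,H)$ is a probability distribution over families $\phi=(\phi_v)_{v\in V}$ of monotone non-decreasing functions $\phi_v:2^{V\setminus\{v\}}\to\{0,1\}$, together with a utility function $H:2^V\to\mathbb{R}_{\ge 0}$, monotone non-decreasing with $H(\emptyset)=0$. A simulation is a draw $\phi\sim\mathcal{G}$. Given $\phi$ and a seed set $S$, $\mathrm{Reach}^0(\phi,S)=S$ and $\mathrm{Reach}^{t+1}(\phi,S)=\mathrm{Reach}^t(\phi,S)\cup\{v\notin \mathrm{Reach}^t(\phi,S): \phi_v(\mathrm{Reach}^t(\phi,S))=1\}$. $R^\tau(S)=H(\mathrm{Reach}^\tau(\phi,S))$ for $\phi\sim\mathcal{G}$, $I^\tau(S)=\mathbb{E}[R^\tau(S)]$,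 and $\mathrm{OPT}^\tau_s=\max_{S:|S|\le s}I^\tau(S)$. Integer rounding of the number of simulations is ignored. *)

(* Defs.v *)
From HB Require Import structures.
From mathcomp Require Import all_boot all_order all_algebra.
From mathcomp Require Import reals exp.

Set Implicit Arguments.
Unset Strict Implicit.
Unset Printing Implicit Defensive.

Import Order.TTheory GRing.Theory Num.Theory.
Local Open Scope ring_scope.

Record fdist (R : realType) (T : finType) := Fdist {
  pmf :> T -> R;
  pmf_ge0 : forall x, 0 <= pmf x;
  pmf_sum1 : \sum_(x : T) pmf x = 1 }.

Section FiniteProbability.
Variables (R : realType) (T : finType) (P : fdist R T).

Definition prob (E : pred T) : R := \sum_(x | E x) P x.

Definition expect (X : T -> R) : R := \sum_(x : T) P x * X x.

Definition variance (X : T -> R) : R :=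
  expect (fun x => (X x - expect X) ^+ 2).

Variable ell : nat.

Definition iid_pmf (w : {ffun 'I_ell -> T}) : R := \prod_(i < ell) P (w i).

Lemma iid_pmf_ge0 w : 0 <= iid_pmf w.
Proof. by apply: prodr_ge0 => i _; apply: pmf_ge0. Qed.

Lemma iid_pmf_sum1 : \sum_(w : {ffun 'I_ell -> T}) iid_pmf w = 1.
Proof.
rewrite -(bigA_distr_bigA (fun (_ : 'I_ell) x => P x)).
by apply: big1 => i _; apply: pmf_sum1.
Qed.

(* The joint law of ell independent draws from P. *)
Definition iid : fdist R {ffun 'I_ell -> T} :=
  Fdist iid_pmf_ge0 iid_pmf_sum1.

End FiniteProbability.

Section Diffusion.
Variable V : finType.

(* phi v is a map 2^(V \ {v}) -> {0,1}: its argument is a set of elements of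
   the subtype of nodes distinct from v. *)
Definition family : finType :=
  {dffun forall v : V, {ffun {set {u : V | u != v}} -> bool}}.

Definition monotone_family (phi : family) : bool :=
  [forall v : V,
    forall A : {set {u : V | u != v}}, forall B : {set {u : V | u != v}},
      (A \subset B) ==> (phi v A ==> phi v B)].

Definition simulation : finType := {phi : family | monotone_family phi}.

(* In step below v \notin A, so A is a subset of V \ {v} and without v A is A
   itself, seen in the subtype. *)
Definition without (v : V) (A : {set V}) : {set {u : V | u != v}} :=
  [set u | val u \in A].

Definition step (phi : simulation) (A : {set V}) : {set V} :=
  A :|: [set v | (v \notin A) && (val phi v (without v A))].

Definition reach (t : nat) (phi : simulation) (S : {set V}) : {set V} :=
  iter t (step phi) S.

Variable R : realType.

Definition is_utility (H : {set V} -> R) : Prop :=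
  [/\ H set0 = 0, forall A, 0 <= H A &
      forall A B : {set V}, A \subset B -> H A <= H B].

(* An SDM G(V, H) is a pair of a utility H and a law G on simulations. *)
Variables (H : {set V} -> R) (tau : nat).

Definition reward (S : {set V}) (phi : simulation) : R := H (reach tau phi S).

Variable G : fdist R simulation.

Definition influence (S : {set V}) : R := expect G (reward S).

(* The influence is nonnegative for a utility H, so the default value 0 of the
   iterated maxima is harmless. *)
Definition max_influence1 : R := \big[Num.max/0]_(v : V) influence [set v].

Definition opt (s : nat) : R :=
  \big[Num.max/0]_(S : {set V} | (#|S| <= s)%N) influence S.

Definition variance_bound (c : R) : Prop :=
  forall T : {set V},
    variance G (reward T)
      <= c * influence T * Num.max (influence T) max_influence1.

End Diffusion.

(* 112 eps^-2 c s ln(n / delta), rounded up to an integer. *)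
Definition num_simulations (R : realType) (n s : nat) (c eps delta : R) : nat :=
  `|Num.ceil (112%:R * eps ^- 2 * c * s%:R * ln (n%:R / delta))|%N.

(* Main.v *)
Require Import Defs.
From HB Require Import structures.
From mathcomp Require Import all_boot all_order all_algebra.
From mathcomp Require Import zify ring lra.
From mathcomp Require boolp.
From mathcomp Require Import reals sequences exp.

(* Median of means.  Split the simulations into m >= 4 s ln(n/delta) blocks of
   k >= 16 c / eps^2 and estimate each influence I(S), |S| <= s, by the median
   over the blocks of the block means; return a maximiser of the estimate.  Since
   I(S) and the singleton influences are at most OPT, the variance bound gives
   Var R(S) <= c OPT^2, so by Chebyshev a block mean is off by eps OPT with
   probability at most 1/16, and by a Chernoff bound at least half of the blocks
   are off with probability at most 2^-m.  There are at most (n+1)^s <= n^(2s)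
   candidates; off the union of their bad events the estimate of an optimal set
   is at least (1 - eps) OPT, so the maximiser also has at least half of its block
   means above (1 - eps) OPT, one of which is accurate. *)

Import Order.TTheory GRing.Theory Num.Theory.
Local Open Scope ring_scope.

(** * Expectation and probability on a finite space *)

Section FiniteExpectation.
Context {R : realType} {T : finType}.
Implicit Types (P : fdist R T) (X Y : T -> R) (E : pred T).

Lemma eq_expect P X Y : X =1 Y -> expect P X = expect P Y.
Proof. by move=> eqXY; apply: eq_bigr => x _; rewrite eqXY. Qed.

Lemma expect_sum P {I : finType} (A : pred I) (X : I -> T -> R) :
  expect P (fun x => \sum_(i | A i) X i x) = \sum_(i | A i) expect P (X i).
Proof.
rewrite /expect exchange_big; apply: eq_bigr => x _.
by rewrite mulr_sumr.
Qed.

Lemma expectZ P a X : expect P (fun x => a * X x) = a * expect P X.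
Proof. by rewrite /expect mulr_sumr; apply: eq_bigr => x _; rewrite mulrCA. Qed.

Lemma expect_cst P a : expect P (fun=> a) = a.
Proof. by rewrite /expect -mulr_suml pmf_sum1 mul1r. Qed.

Lemma expectB_cst P X a : expect P (fun x => X x - a) = expect P X - a.
Proof.
rewrite -[in RHS](expect_cst P a) /expect -sumrB.
by apply: eq_bigr => x _; rewrite mulrBr.
Qed.

Lemma expect_ge0 P X : (forall x, 0 <= X x) -> 0 <= expect P X.
Proof. by move=> X0; apply: sumr_ge0 => x _; rewrite mulr_ge0 ?pmf_ge0. Qed.

Lemma ler_expect P X Y : (forall x, X x <= Y x) -> expect P X <= expect P Y.
Proof. by move=> leXY; apply: ler_sum => x _; rewrite ler_wpM2l ?pmf_ge0. Qed.

Lemma prob_expect P E : prob P E = expect P (fun x => (E x)%:R).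
Proof.
rewrite /prob big_mkcond; apply: eq_bigr => x _.
by case: (E x); rewrite ?mulr1 ?mulr0.
Qed.

Lemma prob_le_expect P E X :
  (forall x, 0 <= X x) -> (forall x, E x -> 1 <= X x) ->
  prob P E <= expect P X.
Proof.
move=> X0 EX; rewrite prob_expect; apply: ler_expect => x.
by case: (boolP (E x)) => [/EX|_].
Qed.

Lemma probT P E : (forall x, E x) -> prob P E = 1.
Proof. by move=> ET; rewrite -(pmf_sum1 P); apply: eq_bigl. Qed.

Lemma probC P E : prob P E = 1 - prob P (predC E).
Proof. by rewrite -(pmf_sum1 P) (bigID E) /= addrK. Qed.

Lemma prob_union P {I : finType} (A : {set I}) (E : I -> pred T) :
  prob P (fun x => [exists i in A, E i x]) <= \sum_(i in A) prob P (E i).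
Proof.
rewrite (eq_bigr (fun i => expect P (fun x => (E i x)%:R))); last first.
  by move=> i _; rewrite prob_expect.
rewrite -expect_sum; apply: prob_le_expect => [x|x /existsP[i /andP[iA Ei]]].
  by apply: sumr_ge0.
by rewrite (bigD1 i) //= Ei lerDl sumr_ge0.
Qed.

End FiniteExpectation.

(** * Independent samples: Chebyshev and Chernoff bounds *)

Section IidSamples.
Context {R : realType} {T : finType}.
Implicit Types (P : fdist R T) (X : T -> R).

Lemma expect_iid_prod P k (g : 'I_k -> T -> R) :
  expect (iid P k) (fun u : {ffun 'I_k -> T} => \prod_i g i (u i)) =
  \prod_i expect P (g i).
Proof.
rewrite /expect (bigA_distr_bigA (fun i x => P x * g i x)).
by apply: eq_bigr => u _; rewrite big_split.
Qed.

Lemma expect_iid1 P k (i : 'I_k) X :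
  expect (iid P k) (fun u : {ffun 'I_k -> T} => X (u i)) = expect P X.
Proof.
(* A statistic of one coordinate is a product whose other factors are 1. *)
pose g l := if l == i then X else (fun=> 1).
rewrite (eq_expect _ _ (fun u : {ffun 'I_k -> T} =>
  \prod_l g l (u l))); last first.
  move=> u; rewrite (bigD1 i) //= /g eqxx big1 ?mulr1 // => l /negPf-> //.
rewrite expect_iid_prod (bigD1 i) //= /g eqxx big1 ?mulr1 // => l /negPf->.
exact: expect_cst.
Qed.

Lemma expect_iid_mul0 P k (i j : 'I_k) X : expect P X = 0 -> i != j ->
  expect (iid P k) (fun u : {ffun 'I_k -> T} => X (u i) * X (u j)) = 0.
Proof.
move=> X0 ij.
pose g l := if (l == i) || (l == j) then X else (fun=> 1).
rewrite (eq_expect _ _ (fun u : {ffun 'I_k -> T} =>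
  \prod_l g l (u l))); last first.
  move=> u; rewrite (bigD1 i) //= (bigD1 j) 1?eq_sym //= /g !eqxx orbT /=.
  by rewrite big1 ?mulr1 // => l /andP[/negPf-> /negPf->].
by rewrite expect_iid_prod (bigD1 i) //= /g eqxx X0 mul0r.
Qed.

Definition mean k X (u : {ffun 'I_k -> T}) : R := (\sum_i X (u i)) / k%:R.
Arguments mean : clear implicits.

(** Expanding the square of the centred sum, independence kills the off-diagonal terms and each of
    the [k] diagonal ones contributes the variance. *)
Lemma expect_mean_dev2 P k X : (0 < k)%N ->
  expect (iid P k) (fun u => (mean k X u - expect P X) ^+ 2) =
  variance P X / k%:R.
Proof.
move=> k0; have k0R : k%:R != 0 :> R by rewrite pnatr_eq0 -lt0n.
pose Y x := X x - expect P X.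
have Y0 : expect P Y = 0 by rewrite expectB_cst subrr.
rewrite (eq_expect _ _ (fun u : {ffun 'I_k -> T} =>
   k%:R ^- 2 * \sum_i \sum_j Y (u i) * Y (u j))); last first.
  move=> u; have -> : mean k X u - expect P X = k%:R^-1 * \sum_i Y (u i).
    rewrite /Y sumrB sumr_const card_ord -mulr_natr /mean; field.
    exact: k0R.
  by rewrite exprMn exprVn [X in _ * X]expr2 big_distrlr.
rewrite expectZ expect_sum (eq_bigr (fun=> variance P X)); last first.
  move=> i _; rewrite expect_sum (bigD1 i) //= big1 ?addr0 => [|j ji].
    rewrite (expect_iid1 P _ i (fun x => Y x * Y x)).
    by apply: eq_expect => x; rewrite expr2.
  by rewrite expect_iid_mul0 // eq_sym.
rewrite sumr_const card_ord -mulr_natr; field; exact: k0R.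
Qed.

Lemma chebyshev_mean P k X t : (0 < k)%N -> 0 < t ->
  prob (iid P k) (fun u => t <= `|mean k X u - expect P X|) <=
  variance P X / (k%:R * t ^+ 2).
Proof.
move=> k0 t0; rewrite invfM mulrA -expect_mean_dev2 // mulrC -expectZ.
apply: prob_le_expect => [u|u tu].
  by rewrite mulr_ge0 ?sqr_ge0 // invr_ge0 sqr_ge0.
rewrite mulrC ler_pdivlMr ?exprn_gt0 // mul1r -[leRHS]real_normK ?num_real //.
by rewrite ler_pXn2r ?nnegrE ?normr_ge0 // ltW.
Qed.

Lemma prob_majority_le P m (E : pred T) : prob P E <= 16^-1 ->
  prob (iid P m)
    (fun u : {ffun 'I_m -> T} => m <= 2 * #|[pred j | E (u j)]|)%N
  <= 2^-1 ^+ m.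
Proof.
move=> pE.
(* Markov for the product of the f (u j): on the event it is at least
   4^-m * 16^(m/2) = 1, while each factor has mean (1 + 15 * prob P E) / 4. *)
pose f x : R := 4^-1 * (if E x then 16 else 1).
have f0 x : 0 <= f x by rewrite /f; case: ifP => _; lra.
apply: (@le_trans _ _
  (expect (iid P m) (fun u : {ffun 'I_m -> T} => \prod_j f (u j)))).
  apply: prob_le_expect => [u|u mu]; first by apply: prodr_ge0.
  rewrite /f big_split prodr_const card_ord /= -big_mkcond /= prodr_const.
  have -> : 16 = 4 ^+ 2 :> R by ring.
  rewrite -exprM exprVn mulrC ler_pdivlMr ?exprn_gt0 // mul1r.
  by rewrite ler_weXn2l // ler1n.
rewrite (expect_iid_prod P m (fun=> f)) prodr_const card_ord.
have Ef : expect P f = 4^-1 * (15 * prob P E + 1).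
  rewrite expectZ; congr (_ * _).
  rewrite prob_expect -expectZ -[X in _ = _ + X](expect_cst P).
  rewrite /expect -big_split.
  apply: eq_bigr => x _ /=; rewrite -mulrDr.
  by case: (E x); rewrite ?mulr1 ?natr1 ?mulr0 ?add0r ?mulr1.
have pE0 : 0 <= prob P E by apply: sumr_ge0 => x _; apply: pmf_ge0.
(* Each factor has mean at most (15/16 + 1)/4 = 31/64, below 1/2. *)
by rewrite Ef; apply: lerXn2r; rewrite ?nnegrE; lra.
Qed.

End IidSamples.
Arguments mean {R T} k X u.

(** * Cutting the sample into independent blocks *)

Definition blocks {T : finType} {ell m k : nat} (h : 'I_m * 'I_k -> 'I_ell)
    (w : {ffun 'I_ell -> T}) : {ffun 'I_m -> {ffun 'I_k -> T}} :=
  [ffun j => [ffun i => w (h (j, i))]].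

(** Fixing the blocks fixes [w] on the image of [h], with the weight of the block array; every
    coordinate outside the image is free and sums to 1. Surplus simulations are thus harmless. *)
Lemma expect_blocks {R : realType} {T : finType} (P : fdist R T) ell m k
    (h : 'I_m * 'I_k -> 'I_ell) (F : {ffun 'I_m -> {ffun 'I_k -> T}} -> R) :
  injective h ->
  expect (iid P ell) (fun w => F (blocks h w)) = expect (iid (iid P k) m) F.
Proof.
move=> hinj; rewrite /expect (partition_big (blocks h) xpredT) //=.
apply: eq_bigr => u _.
rewrite (eq_bigr (fun w => iid_pmf P w * F u)); last by move=> w /eqP->.
rewrite -mulr_suml; congr (_ * _).
(* [Q l] holds the values allowed at coordinate [l]: a single one on the image of [h], all of [T]
   elsewhere. *)
pose Q l := [pred x | [forall p, (h p == l) ==> (u p.1 p.2 == x)]].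
rewrite (eq_bigl (fun w : {ffun 'I_ell -> T} => w \in family Q)); last first.
  move=> w; apply/eqP/familyP => [uE l|wQ].
    rewrite inE; apply/forallP => -[j i]; apply/implyP => /eqP <-.
    by rewrite -uE !ffunE.
  apply/ffunP => j; apply/ffunP => i; rewrite !ffunE.
  by have /forallP/(_ (j, i)) := wQ (h (j, i)); rewrite eqxx => /eqP.
rewrite -(bigA_distr_big_dep Q (fun _ x => P x)) /=.
rewrite (bigID (mem (h @: setT))) /= [X in _ * X]big1 ?mulr1 => [|l lh].
  rewrite big_imset /= => [|p q _ _]; last exact: hinj.
  rewrite /iid_pmf pair_big /=; apply: eq_big => [p|p _]; first by rewrite inE.
  rewrite (big_pred1 (u p.1 p.2)) // => x /=.
  apply/forallP/eqP => [/(_ p)|-> q].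
    by rewrite eqxx => /eqP.
  by apply/implyP => /eqP/hinj ->.
rewrite -[RHS](pmf_sum1 P); apply: eq_bigl => x; apply/forallP => p.
by apply/implyP => /eqP hp; case/negP: lh; apply/imsetP; exists p.
Qed.

Lemma prob_blocks {R : realType} {T : finType} (P : fdist R T) ell m k
    (h : 'I_m * 'I_k -> 'I_ell) (E : pred {ffun 'I_m -> {ffun 'I_k -> T}}) :
  injective h ->
  prob (iid P ell) (fun w => E (blocks h w)) = prob (iid (iid P k) m) E.
Proof.
move=> hinj; rewrite !prob_expect.
by rewrite (expect_blocks P _ _ _ h (fun u => (E u)%:R)).
Qed.

(** * Medians and majorities *)

Section Median.
Context {R : realType} {m : nat}.
Implicit Types (a : 'I_m -> R) (t : R).

(* The default value 0 of the maximum is why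
   median_ge is stated for positive thresholds. *)
Definition median a : R :=
  \big[Num.max/0]_(j | (m <= 2 * #|[pred i | (a j <= a i)%R]|)%N) a j.

Lemma median_ge a t : (0 < m)%N -> 0 < t ->
  (t <= median a) = (m <= 2 * #|[pred i | (t <= a i)%R]|)%N.
Proof.
move=> m0 t0; apply/boolp.bigmax_geP/idP => [[|[j mj tj]]|mt].
- by rewrite leNgt t0.
- apply: leq_trans mj _; rewrite leq_mul2l /=; apply: subset_leq_card.
  by apply/subsetP => i; rewrite !inE; apply: le_trans.
have [j0 tj0] : exists j, t <= a j.
  case: (pickP [pred i | t <= a i]) => [j tj|none]; first by exists j.
  by move: mt; rewrite (eq_card0 none) muln0 leqNgt m0.
(* The least value above [t] lies below all the others above [t], so it qualifies as a candidate of
   the maximum. *)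
right; case: (@arg_minP _ _ _ j0 (fun i => t <= a i) a tj0) => j tj jmin.
exists j => //.
apply: leq_trans mt _; rewrite leq_mul2l /=; apply: subset_leq_card.
by apply/subsetP => i; rewrite !inE => /jmin.
Qed.

Lemma majority_meet (A B : pred 'I_m) : (m <= 2 * #|A|)%N ->
  (m > 2 * #|B|)%N -> exists2 j, A j & ~~ B j.
Proof.
move=> mA mB; case: (pickP [pred j | A j && ~~ B j]) => [j /andP[]|none].
  by exists j.
have : (#|A| <= #|B|)%N.
  apply: subset_leq_card; apply/subsetP => j jA; apply/negPn/negP => jB.
  by move: (none j); rewrite /= (jA : A j) (jB : ~~ B j).
by rewrite -(leq_pmul2l (isT : 0 < 2)%N) leqNgt (leq_trans mB).
Qed.

End Median.

(** * Selection among finitely many candidates *)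

Lemma card_small_sets (V : finType) s :
  (#|[set S : {set V} | #|S| <= s]| <= #|V|.+1 ^ s)%N.
Proof.
(* [None] pads sets with fewer than [s] elements, whence the base [#|V|.+1]. *)
pose f (g : {ffun 'I_s -> option V}) := [set v | Some v \in codom g].
apply: (@leq_trans #|[set f g | g in [set: {ffun 'I_s -> option V}]]|).
  apply: subset_leq_card; apply/subsetP => S; rewrite inE => Ss.
  apply/imsetP; exists [ffun i : 'I_s => nth None (map Some (enum S)) i] => //.
  apply/setP => v; rewrite inE; apply/idP/codomP => [vS|[i]].
    have iS : (index v (enum S) < #|S|)%N by rewrite cardE index_mem mem_enum.
    exists (Ordinal (leq_trans iS Ss)); rewrite ffunE /= (nth_map v) -?cardE //.
    by rewrite nth_index // mem_enum.
  rewrite ffunE; case: (ltnP i #|S|) => [iS|iS]; last first.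
    by rewrite nth_default // size_map -cardE.
  by rewrite (nth_map v) -?cardE // => -[->]; rewrite -mem_enum mem_nth -?cardE.
apply: leq_trans (leq_imset_card _ _) _.
by rewrite cardsT card_ffun card_option card_ord.
Qed.

(** [select] is fixed before [P] and [t]: the procedure sees the law only through its samples, and
    the accuracy [t], later eps OPT, is unknown to it. *)
Lemma median_of_means_select {R : realType} {T I : finType} (A : {set I})
    (i0 : I) (X : I -> T -> R) (ell k m : nat) :
  i0 \in A -> (0 < k)%N -> (0 < m)%N -> (m * k <= ell)%N ->
  exists2 select : {ffun 'I_ell -> T} -> I, forall w, select w \in A &
    forall (P : fdist R T) (t : R) (i : I), 0 < t -> i \in A ->
      t < expect P (X i) ->
      (forall j, j \in A -> 16 * variance P (X j) <= k%:R * t ^+ 2) ->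
      1 - #|A|%:R * 2^-1 ^+ m <=
        prob (iid P ell)
          (fun w => expect P (X i) - 2 * t <= expect P (X (select w))).
Proof.
move=> i0A k0 m0 mk.
have card_le : (#|{: 'I_m * 'I_k}| <= ell)%N by rewrite card_prod !card_ord.
pose h p := widen_ord card_le (enum_rank p).
have hinj : injective h by move=> p q /(congr1 val)/= /val_inj/enum_rank_inj.
pose est (u : {ffun 'I_m -> {ffun 'I_k -> T}}) i :=
  median (fun j => mean k (X i) (u j)).
pose sel u := [arg max_(i > i0 | i \in A) est u i]%O.
exists (fun w => sel (blocks h w)) => [w|P t i t0 iA ti varA].
  by rewrite /sel; case: arg_maxP.
rewrite (prob_blocks _ _ _ _ h
  (fun u => expect P (X i) - 2 * t <= expect P (X (sel u)))) //.
pose dev i (v : {ffun 'I_k -> T}) := t <= `|mean k (X i) v - expect P (X i)|.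
pose bad i (u : {ffun 'I_m -> {ffun 'I_k -> T}}) :=
  (m <= 2 * #|[pred j | dev i (u j)]|)%N.
rewrite probC lerD2l lerN2.
apply: le_trans
  (_ : prob (iid (iid P k) m) (fun u => [exists j in A, bad j u]) <= _).
  rewrite [leRHS]prob_expect.
  apply: prob_le_expect => [u|u /=]; first exact: ler0n.
  case: existsP => // noBad; case/negP.
  have good j : j \in A -> (2 * #|[pred l | dev j (u l)]| < m)%N.
    move=> jA; rewrite ltnNge; apply/negP => badj.
    by case: noBad; exists j; rewrite jA.
  (* The threshold must be positive for [median_ge], because of the default 0 in [median]. *)
  have th0 : 0 < expect P (X i) - t by rewrite subr_gt0.
  have est_i : expect P (X i) - t <= est u i.
    rewrite median_ge //.
    pose C := [pred l | dev i (u l)].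
    have Cm : (#|C| + #|predC C| = m)%N by rewrite cardC card_ord.
    have CD : (#|predC C| <=
        #|[pred l | (expect P (X i) - t <= mean k (X i) (u l))%R]|)%N.
      apply: subset_leq_card; apply/subsetP => l; rewrite !inE /dev -ltNge.
      by rewrite ltr_norml => /andP[]; lra.
    have Cg : (2 * #|C| < m)%N := good _ iA.
    apply: leq_trans (_ : 2 * #|predC C| <= _)%N; last by rewrite leq_mul2l.
    by move: Cm Cg; move: #|C| #|predC C| => x y; lia.
  have [selA est_sel] : sel u \in A /\ est u i <= est u (sel u).
    by rewrite /sel; case: arg_maxP => // j jA jmax; split=> //; apply: jmax.
  have : expect P (X i) - t <= est u (sel u) by apply: le_trans est_sel.
  (* Some block [l] of the selected candidate has a mean that is both high and within [t] of its
     expectation, which costs a second [t]. *)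
  rewrite median_ge // => /majority_meet /(_ (good _ selA)) [l] /=.
  by rewrite /dev -ltNge ltr_norml => lel /andP[]; lra.
apply: (le_trans (prob_union _ A bad)).
rewrite mulr_natl -sumr_const; apply: ler_sum => j jA.
apply: (prob_majority_le (iid P k) m (dev j)).
apply: le_trans (chebyshev_mean _ _ _ _ k0 t0) _.
have kt0 : 0 < k%:R * t ^+ 2 :> R by rewrite mulr_gt0 ?ltr0n ?exprn_gt0.
rewrite ler_pdivrMr // mulrC ler_pdivlMr // mulrC.
exact: varA.
Qed.

(** * Number and length of the blocks *)

Lemma absz_ceil {R : realType} (x : R) : 0 <= x ->
  x <= `|Num.ceil x|%N%:R < x + 1.
Proof.
move=> x0; have /andP[cl cu] := ceil_itv x.
have c0 : 0 <= Num.ceil x by rewrite -(ler0z R); apply: le_trans cu.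
rewrite natr_absz ger0_norm // cu /=.
by move: cl; rewrite intrB; lra.
Qed.

Lemma num_blocks_bound {R : realType} (n s : nat) (c eps delta : R) :
  1 <= c -> 0 < eps < 1 -> 0 < delta < 1 -> (1 < n)%N -> (0 < s)%N ->
  exists k m : nat,
    [/\ (0 < k)%N, (0 < m)%N, (m * k <= num_simulations n s c eps delta)%N,
        16 * c <= k%:R * eps ^+ 2 &
        (n.+1 ^ s)%:R * 2^-1 ^+ m <= delta].
Proof.
move=> c1 /andP[e0 e1] /andP[d0 d1] n1 s0.
pose D := c * eps ^- 2; pose L := s%:R * ln (n%:R / delta).
have e20 : 0 < eps ^+ 2 by rewrite exprn_gt0.
have D1 : 1 <= D.
  rewrite /D ler_pdivlMr // mul1r; apply: le_trans c1.
  by rewrite exprn_ile1 // ltW.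
(* Replaces base 2 by base e: it yields both ln 2 >= 1/2 and 2^m >= e^(m/2). *)
have exp_half : expR (2^-1) <= 2 :> R.
  have := expR_ge1Dx (- 2^-1 : R); rewrite expRN.
  have := expR_gt0 (2^-1 : R); move: (expR _) => x x0.
  by rewrite -[x^-1]mul1r ler_pdivlMr //; lra.
have n2 : 2 <= n%:R :> R by rewrite ler_nat.
have nd2 : 2 <= n%:R / delta by rewrite ler_pdivlMr //; nra.
have L_half : 2^-1 <= L.
  have : 2^-1 <= ln (n%:R / delta).
    rewrite -[leLHS]expRK ler_ln ?posrE ?expR_gt0 ?(lt_le_trans _ nd2) //.
    exact: le_trans nd2.
  have : 1 <= s%:R :> R by rewrite ler1n.
  by rewrite /L; nra.
set ell := num_simulations _ _ _ _ _.
have ell_ge : 112 * D * L <= ell%:R.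
  have -> : 112 * D * L = 112%:R * eps ^- 2 * c * s%:R * ln (n%:R / delta).
    by rewrite /D /L; ring.
  have /absz_ceil/andP[] // :
    0 <= 112%:R * eps ^- 2 * c * s%:R * ln (n%:R / delta).
  have -> : 112%:R * eps ^- 2 * c * s%:R * ln (n%:R / delta) = 112 * (D * L).
    by rewrite /D /L; ring.
  by rewrite (mulr_ge0 _ (mulr_ge0 _ _)) //; lra.
pose k := `|Num.ceil (16 * D)|%N.
have /andP[k_ge k_lt] : 16 * D <= k%:R < 16 * D + 1 by apply: absz_ceil; lra.
have k0 : (0 < k)%N by rewrite -(ltr0n R); lra.
pose m := (ell %/ k)%N.
(* As D >= 1, k <= 17 D, so m + 1 >= 112 L / 17; the lost 1 is absorbed because L >= 1/2. *)
have m_ge : 4 * L <= m%:R.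
  have : (ell%:R : R) <= m.+1%:R * k%:R.
    by rewrite -natrM ler_nat ltnW // ltn_ceil.
  rewrite -natr1 => lem.
  have m1 : 0 <= (m%:R : R) by exact: ler0n.
  have : 112 * D * L <= (m%:R + 1) * (17 * D).
    apply: le_trans ell_ge (le_trans lem _); rewrite ler_wpM2l //; lra.
  rewrite mulrAC [leRHS]mulrA ler_pM2r; lra.
have m0 : (0 < m)%N by rewrite -(ltr0n R); lra.
exists k, m; split => //; first exact: leq_trunc_div.
  rewrite -ler_pdivrMr // -mulrA; exact: k_ge.
rewrite exprVn ler_pdivrMr ?exprn_gt0 //.
have pow_m : (n%:R / delta) ^+ (2 * s) <= 2 ^+ m :> R.
  apply: le_trans (_ : expR (2^-1) ^+ m <= _); last first.
    by apply: lerXn2r; rewrite ?nnegrE ?expR_ge0.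
  rewrite -expRM_natr -[X in X ^+ _]lnK ?posrE; last by lra.
  rewrite -expRM_natl ler_expR natrM -mulrA -/L; lra.
(* Here n >= 2 matters, for n + 1 <= n^2. *)
have pow_n : ((n.+1 ^ s)%:R : R) <= n%:R ^+ (2 * s).
  by rewrite -natrX ler_nat expnM leq_exp2r // -mulnn ltn_Pmulr // ltnW.
have delta_pow : delta ^+ (2 * s) <= delta.
  by rewrite ler_iXnr ?muln_gt0 // ltW.
apply: (le_trans pow_n).
rewrite -[n%:R](@divfK _ delta) ?gt_eqF // exprMn [leRHS]mulrC.
by apply: ler_pM pow_m delta_pow; rewrite exprn_ge0 ?divr_ge0 ?ler0n // ltW.
Qed.

(** * Influence and its optimum *)

Lemma reach_full (V : finType) t (phi : simulation V) : reach t phi setT = setT.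
Proof.
elim: t => // t IHt; rewrite /reach iterS -/(reach t phi setT) IHt.
by rewrite /step setTU.
Qed.

Section Influence.
Context {R : realType} {V : finType} {H : {set V} -> R}.
Context (hH : is_utility H) (tau : nat) (G : fdist R (simulation V)).

Lemma influence_ge0 (S : {set V}) : 0 <= influence H tau G S.
Proof. by case: hH => _ H0 _; apply: expect_ge0 => phi; apply: H0. Qed.

Lemma influence_le_full (S : {set V}) :
  influence H tau G S <= influence H tau G setT.
Proof.
case: hH => _ _ Hmono; apply: ler_expect => phi.
by rewrite /reward reach_full; apply: Hmono; apply: subsetT.
Qed.

Lemma influence_le_opt s (S : {set V}) : (#|S| <= s)%N ->
  influence H tau G S <= opt H tau G s.
Proof. exact: le_bigmax_cond. Qed.

Lemma max_influence1_le_opt s : (0 < s)%N ->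
  max_influence1 H tau G <= opt H tau G s.
Proof.
move=> s0; apply: bigmax_le => [|v _]; first exact: bigmax_ge_id.
by apply: influence_le_opt; rewrite cards1.
Qed.

Lemma opt_attained s :
  exists2 S : {set V}, (#|S| <= s)%N & opt H tau G s = influence H tau G S.
Proof.
rewrite /opt (bigmax_eq_arg _ set0); last 2 first.
- by rewrite cards0.
- by move=> S _; apply: influence_ge0.
by case: arg_maxP => [|S Ss _]; [rewrite cards0 | exists S].
Qed.

Lemma variance_le_opt c s (S : {set V}) : 1 <= c -> (0 < s)%N ->
  variance_bound H tau G c -> (#|S| <= s)%N ->
  variance G (reward H tau S) <= c * opt H tau G s ^+ 2.
Proof.
move=> c1 s0 hvar Ss; apply: le_trans (hvar S) _.
have I0 := influence_ge0 S; have IO := influence_le_opt _ _ Ss.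
rewrite -mulrA ler_wpM2l ?(le_trans ler01) // expr2 ler_pM //.
  by rewrite le_max I0.
by rewrite ge_max IO max_influence1_le_opt.
Qed.

End Influence.

Theorem theorem6p1 (R : realType) (V : finType) (H : {set V} -> R)
    (hH : is_utility H) (tau : nat) (c : R) (hc : 1 <= c)
    (eps delta : R) (heps : 0 < eps < 1) (hdelta : 0 < delta < 1)
    (s : nat) (hs : (1 <= s <= #|V|)%N) :
  let ell := num_simulations #|V| s c eps delta in
  exists select : {ffun 'I_ell -> simulation V} -> {set V},
    (forall w, (#|select w| <= s)%N) /\
    forall G : fdist R (simulation V),
      variance_bound H tau G c ->
      1 - delta <=
        prob (iid G ell)
          (fun w => (1 - 2%:R * eps) * opt H tau G s
                      <= influence H tau G (select w)).
Proof.
move=> ell; have /andP[s1 _] := hs.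
have /andP[e0 e1] := heps; have /andP[d0 d1] := hdelta.
have scale_le (G : fdist R (simulation V)) x : opt H tau G s <= x ->
    0 <= opt H tau G s -> (1 - 2%:R * eps) * opt H tau G s <= x by nra.
have opt0 G : 0 <= opt H tau G s by apply: bigmax_ge_id.
(* The block bounds require two nodes; with a single one the full set fits the budget and has the
   largest influence. *)
have [n1|n1] := leqP #|V| 1.
  exists (fun=> setT); split=> [w|G _]; first by rewrite cardsT (leq_trans n1).
  rewrite probT; first by lra.
  move=> w; apply: scale_le => //; have [S _ ->] := opt_attained hH tau G s.
  exact: influence_le_full.
have [k [m [k0 m0 mk k_ge err_le]]] :=
  num_blocks_bound #|V| s c eps delta hc heps hdelta n1 s1.
pose A := [set S : {set V} | (#|S| <= s)%N].
have A0 : set0 \in A by rewrite inE cards0.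
have [select selA sel_ok] :=
  median_of_means_select A set0 (reward H tau) ell k m A0 k0 m0 mk.
exists select; split=> [w|G hvar]; first by have := selA w; rewrite inE.
have [S Ss optS] := opt_attained hH tau G s.
(* The accuracy eps OPT has to be positive; if OPT = 0, any set succeeds. *)
have := opt0 G; rewrite le_eqVlt => /predU1P[opt_eq0|opt_gt0].
  rewrite probT; first by lra.
  by move=> w; rewrite -opt_eq0 mulr0 influence_ge0.
have SA : S \in A by rewrite inE.
apply: le_trans (_ : 1 - #|A|%:R * 2^-1 ^+ m <= _).
  rewrite lerD2l lerN2; apply: le_trans err_le.
  by rewrite ler_wpM2r ?exprn_ge0 ?invr_ge0 // ler_nat card_small_sets.
have -> : (1 - 2%:R * eps) * opt H tau G s =
    expect G (reward H tau S) - 2 * (eps * opt H tau G s).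
  by rewrite -/(influence H tau G S) -optS; ring.
apply: sel_ok => //; first exact: mulr_gt0.
  by rewrite -/(influence H tau G S) -optS gtr_pMl.
move=> U; rewrite inE => Us.
have := variance_le_opt hH tau G c s U hc s1 hvar Us.
move=> vU; apply: le_trans (_ : 16 * (c * opt H tau G s ^+ 2) <= _).
  by rewrite ler_wpM2l.
by rewrite exprMn mulrA [leRHS]mulrA ler_wpM2r ?sqr_ge0.
Qed.
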